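(* Let $f=\sum_{n\in\mathbb Z}a_nz^n$ be a formal Laurent series over $\mathbb C$. Define infinite matrices $A_1[f]=[v_{i,j}]_{i,j\in\mathbb N}$ and $A_2[f]=[u_{i,j}]_{i,j\in\mathbb N}$ ($i$ the row index, $j$ the column index) by $$v_{i,j}=a_{1-j+(-1)^i\lfloor i/2\rfloor},\qquad u_{i,j}=a_{j+(-1)^i\lfloor i/2\rfloor}.$$ Then a formal Laurent series $g=\sum_{n\in\mathbb Z}d_nz^n$ belongs to $R(f)$ if and only if there exists a complex sequence $s=[s_1\ s_2\ \dots]^T$ such that the sequences $x=[x_1\ x_2\ \dots]^T$ with $x_i=d_{i-1}$ and $y=[y_1\ y_2\ \dots]^T$ with $y_i=d_{-i}$ ($i\in\mathbb N$) satisfy the infinite systems $$A_1[f]x=s\quad\text{and}\quad A_2[f]y=[1\ 0\ 0\ \dots]^T-s,$$ that is, $\sum_{j=1}^\infty v_{i,j}x_j=s_i$ and $\sum_{j=1}^\infty u_{i,j}y_j=\delta_{i,1}-s_i$ for all $i\in\mathbb N$ (all series being convergent).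
   Context: A formal Laurent series over $\mathbb C$ is a mapping $f:\mathbb Z\to\mathbb C$, written $f=\sum_{n\in\mathbb Z}a_nz^n$ with $a_n=f(n)$ (arbitrarily many nonzero coefficients with negative index are allowed); $\mathbb L$ is the set of all of them. For complex $(c_n)_{n\in\mathbb Z}$, $\sum_{n\in\mathbb Z}c_n:=\sum_{n=1}^\infty c_{-n}+\sum_{n=0}^\infty c_n$, convergent iff both one-sided series converge. The product of $g=\sum b_nz^n$ and $f=\sum a_nz^n$ is $gf:=\sum_{n\in\mathbb Z}\left(\sum_{m\in\mathbb Z}b_ma_{n-m}\right)z^n$, provided all sums over $m$ converge. $g$ is an inverse of $f$ iff $fg$ exists and $fg=1$ (the series with coefficients $\delta_{n,0}$); $R(f)$ is the set of all inverses of $f$ in $\mathbb L$. $\mathbb N=\{1,2,\dots\}$. *)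

(* Defs.v *)
From Stdlib Require Import Reals ZArith.
From Coquelicot Require Import Coquelicot.

Definition laurent : Type := Z -> C.

(* Convergence of a two-sided series: the two one-sided series
   sum_{n >= 1} c_{-n} and sum_{n >= 0} c_n are required to converge
   separately, and the value is the sum of their sums. *)
Definition is_zseries (c : Z -> C) (l : C) : Prop :=
  exists l1 l2 : C,
    is_series (fun k : nat => c (- Z.of_nat (S k))%Z) l1 /\
    is_series (fun k : nat => c (Z.of_nat k)) l2 /\
    l = Cplus l1 l2.

(* [is_lprod g f h]: the product g f exists and equals h. *)
Definition is_lprod (g f h : laurent) : Prop :=
  forall n : Z, is_zseries (fun m : Z => Cmult (g m) (f (n - m)%Z)) (h n).

Definition lone : laurent :=
  fun n => if Z.eqb n 0 then RtoC 1 else RtoC 0.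

(* [inverses f g] means that g belongs to the set R(f). *)
Definition inverses (f : laurent) : laurent -> Prop :=
  fun g => is_lprod f g lone.

(* Infinite matrices and sequences are indexed by {1, 2, ...}: values at
   index 0 are never used. *)
Definition is_infsystem (A : nat -> nat -> C) (x b : nat -> C) : Prop :=
  forall i : nat, (1 <= i)%nat ->
    is_series (fun k : nat => Cmult (A i (S k)) (x (S k))) (b i).

Definition alt_index (i : nat) : Z :=
  ((-1) ^ Z.of_nat i * (Z.of_nat i / 2))%Z.

Definition matA1 (a : laurent) (i j : nat) : C :=
  a (1 - Z.of_nat j + alt_index i)%Z.

Definition matA2 (a : laurent) (i j : nat) : C :=
  a (Z.of_nat j + alt_index i)%Z.

(* The sequence [1 0 0 ...]^T, indexed from 1. *)
Definition delta1 (i : nat) : C := if Nat.eqb i 1 then RtoC 1 else RtoC 0.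

(* Main.v *)
Require Import Defs.
From Stdlib Require Import Reals ZArith Lia IndefiniteDescription.
From Coquelicot Require Import Coquelicot.

(** The coefficient of [z^n] in [f g] is the two-sided sum of [f m * g (n - m)]
    over [m].  Substituting [m -> n - m] turns it into the two-sided sum of
    [f (n - m) * g m], whose nonnegative half pairs [f] with the entries
    [g 0, g 1, ...] of [x] and whose negative half pairs [f] with the entries
    [g (-1), g (-2), ...] of [y].  The row [i] of the two systems is exactly
    this pair of half sums for [n = alt_index i]; since [alt_index] enumerates
    all of [Z] as 0, 1, -1, 2, -2, ..., the rows of the systems account for all
    the equations of [f g = 1].  The sequence [s] records how the value of each
    coefficient is split between the two halves.

    The substitution is not formal, because a two-sided series converges only
    through its two halves at the fixed cut between -1 and 0, and [m -> n - m]
    moves that cut.  But it moves it by finitely many terms, which pass from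
    one half to the other and change neither the convergence nor the total
    ([is_zseries_reflect]). *)

(** * Two-sided series under affine substitutions *)

Lemma is_zseries_ext (c d : Z -> C) (l : C) :
  (forall m, c m = d m) -> is_zseries c l -> is_zseries d l.
Proof.
intros E (l1 & l2 & H1 & H2 & ->); exists l1, l2; repeat split.
- now apply (is_series_ext _ _ _ (fun k => E _)) in H1.
- now apply (is_series_ext _ _ _ (fun k => E _)) in H2.
Qed.

(** The reflection [m -> -1 - m] fixes the cut between -1 and 0, so it merely
    exchanges the two halves. *)
Lemma is_zseries_swap (c : Z -> C) (l : C) :
  is_zseries c l -> is_zseries (fun m => c (-1 - m)%Z) l.
Proof.
intros (l1 & l2 & H1 & H2 & ->); exists l2, l1; repeat split.
- apply is_series_ext with (2 := H2); intros k; f_equal; lia.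
- apply is_series_ext with (2 := H1); intros k; f_equal; lia.
- apply Cplus_comm.
Qed.

(** Shifting by one moves the term [c 0] from the nonnegative half to the
    negative one. *)
Lemma is_zseries_succ (c : Z -> C) (l : C) :
  is_zseries c l -> is_zseries (fun m => c (m + 1)%Z) l.
Proof.
intros (l1 & l2 & H1 & H2 & ->).
exists (Cplus l1 (c 0%Z)), (Cminus l2 (c 0%Z)); repeat split.
- apply is_series_ext with (a := fun k => c (- Z.of_nat k)%Z).
  { intros k; f_equal; lia. }
  apply is_series_decr_1.
  replace (plus _ _) with l1; [exact H1|].
  change (l1 = Cplus (Cplus l1 (c 0%Z)) (Copp (c 0%Z))); ring.
- apply is_series_ext with (a := fun k => c (Z.of_nat (S k))).
  { intros k; f_equal; lia. }
  apply (is_series_incr_1 (fun k => c (Z.of_nat k))).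
  replace (plus _ _) with l2; [exact H2|].
  change (l2 = Cplus (Cminus l2 (c 0%Z)) (c 0%Z)); ring.
- ring.
Qed.

Lemma is_zseries_pred (c : Z -> C) (l : C) :
  is_zseries c l -> is_zseries (fun m => c (m - 1)%Z) l.
Proof.
(* The backward shift is the forward one conjugated by the reflection. *)
intros H; apply is_zseries_swap, is_zseries_succ, is_zseries_swap in H.
apply is_zseries_ext with (2 := H); intros m; f_equal; lia.
Qed.

Lemma is_zseries_shift (c : Z -> C) (l : C) (p : Z) :
  is_zseries c l -> is_zseries (fun m => c (m + p)%Z) l.
Proof.
intros H; induction p as [|p IH|p IH] using Z.peano_ind.
- apply is_zseries_ext with (2 := H); intros m; f_equal; lia.
- apply is_zseries_succ in IH.
  apply is_zseries_ext with (2 := IH); intros m; f_equal; lia.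
- apply is_zseries_pred in IH.
  apply is_zseries_ext with (2 := IH); intros m; f_equal; lia.
Qed.

(** Every reflection of [Z] is a shift followed by the one that fixes the
    cut. *)
Lemma is_zseries_reflect (c : Z -> C) (l : C) (n : Z) :
  is_zseries c l -> is_zseries (fun m => c (n - m)%Z) l.
Proof.
intros H; apply (is_zseries_shift _ _ (n + 1)), is_zseries_swap in H.
apply is_zseries_ext with (2 := H); intros m; f_equal; lia.
Qed.

Lemma is_lprod_comm (f g h : laurent) : is_lprod f g h -> is_lprod g f h.
Proof.
intros H n; generalize (is_zseries_reflect _ _ n (H n)).
apply is_zseries_ext; intros m; rewrite Cmult_comm; do 2 f_equal; lia.
Qed.

(** * The enumeration 0, 1, -1, 2, -2, ... of the integers *)

Lemma alt_index_even (p : nat) : alt_index (2 * p) = Z.of_nat p.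
Proof.
unfold alt_index; rewrite Nat2Z.inj_mul, Z.pow_mul_r by lia.
rewrite Z.pow_1_l by lia.
rewrite Z.mul_comm with (n := Z.of_nat 2), Z.div_mul by easy; lia.
Qed.

Lemma alt_index_odd (p : nat) : alt_index (2 * p + 1) = (- Z.of_nat p)%Z.
Proof.
unfold alt_index.
replace (Z.of_nat (2 * p + 1)) with (Z.succ (2 * Z.of_nat p)) by lia.
rewrite Z.pow_succ_r, Z.pow_mul_r, Z.pow_1_l by lia.
replace (Z.succ (2 * Z.of_nat p) / 2)%Z with (Z.of_nat p); [lia|].
apply Z.div_unique with 1%Z; lia.
Qed.

Lemma alt_index_surj (n : Z) : exists i, (1 <= i)%nat /\ alt_index i = n.
Proof.
destruct (Z_lt_le_dec 0 n) as [Hn|Hn].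
- exists (2 * Z.to_nat n)%nat; rewrite alt_index_even; lia.
- exists (2 * Z.to_nat (- n) + 1)%nat; rewrite alt_index_odd; lia.
Qed.

Lemma lone_alt_index (i : nat) : (1 <= i)%nat -> lone (alt_index i) = delta1 i.
Proof.
intros Hi; unfold lone, delta1.
destruct (Z.eqb_spec (alt_index i) 0) as [E|E];
  destruct (Nat.eqb_spec i 1) as [F|F]; try reflexivity; exfalso.
- destruct (Nat.Even_or_Odd i) as [[p ->]|[p ->]].
  + rewrite alt_index_even in E; lia.
  + rewrite alt_index_odd in E; lia.
- now subst i.
Qed.

(** * Rows of the systems and coefficients of the product *)

Definition row_eqs (f g : laurent) (i : nat) (t u : C) : Prop :=
  is_series (fun k : nat => Cmult (matA1 f i (S k)) (g (Z.of_nat (S k) - 1)%Z)) t /\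
  is_series (fun k : nat => Cmult (matA2 f i (S k)) (g (- Z.of_nat (S k))%Z)) u.

(** Row [i] is the coefficient of index [alt_index i], cut in halves along the
    index of [g]; this is why the factor [g] comes first on the left. *)
Lemma coef_row_eqs (f g : laurent) (i : nat) (l : C) :
  is_zseries (fun m => Cmult (g m) (f (alt_index i - m)%Z)) l <->
  exists t, row_eqs f g i t (Cminus l t).
Proof.
split.
- intros (l1 & l2 & H1 & H2 & ->); exists l2; split.
  + apply is_series_ext with (2 := H2); intros k; unfold matA1.
    rewrite Cmult_comm; f_equal; f_equal; lia.
  + replace (Cminus (Cplus l1 l2) l2) with l1 by ring.
    apply is_series_ext with (2 := H1); intros k; unfold matA2.
    rewrite Cmult_comm; f_equal; f_equal; lia.
- intros (t & H1 & H2); exists (Cminus l t), t; repeat split.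
  + apply is_series_ext with (2 := H2); intros k; unfold matA2.
    rewrite Cmult_comm; f_equal; f_equal; lia.
  + apply is_series_ext with (2 := H1); intros k; unfold matA1.
    rewrite Cmult_comm; f_equal; f_equal; lia.
  + ring.
Qed.

Theorem proposition4p6 (f g : laurent) :
  inverses f g <->
  exists s : nat -> C,
    is_infsystem (matA1 f) (fun i : nat => g (Z.of_nat i - 1)%Z) s /\
    is_infsystem (matA2 f) (fun i : nat => g (- Z.of_nat i)%Z)
      (fun i : nat => Cminus (delta1 i) (s i)).
Proof.
split.
- intros H; apply is_lprod_comm in H.
  (* Row 0 carries no equation, so the choice is made over all indices with
     the bound inside the predicate. *)
  destruct (functional_choice
    (fun i t => (1 <= i)%nat -> row_eqs f g i t (Cminus (delta1 i) t)))
    as [s Hs].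
  { intros i; destruct (Nat.eq_dec i 0) as [->|Hi].
    - exists (RtoC 0); lia.
    - generalize (H (alt_index i)); rewrite lone_alt_index by lia.
      intros Hi'; apply coef_row_eqs in Hi' as [t Ht]; now exists t. }
  exists s; split; intros i Hi; apply (Hs i Hi).
- intros (s & H1 & H2); apply is_lprod_comm; intros n.
  destruct (alt_index_surj n) as (i & Hi & <-).
  rewrite lone_alt_index by exact Hi.
  apply coef_row_eqs; exists (s i); split; [apply (H1 i Hi)|apply (H2 i Hi)].
Qed.
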